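(* For all integers $a,b,c$ we have $$J^{\mathrm{FKB}}_\Delta(a,b,c)=J_\Delta(a,b,c).$$
   Context: Notation: $(q)_n=(q;q)_n=\prod_{j=1}^n(1-q^j)$ for $n\ge0$, $(q)_\infty=\prod_{j\ge1}(1-q^j)$, and $1/(q)_n=0$ for $n<0$. All identities are between Laurent series in $q^{1/2}$. The tetrahedron index is, for $m,e\in\mathbb Z$, $$I_\Delta(m,e)(q)=\sum_{n\ge\max\{0,-e\}}(-1)^n\frac{q^{\frac12n(n+1)-(n+\frac12e)m}}{(q)_n(q)_{n+e}}.$$ For $a,b,c\in\mathbb Z$, $$J_\Delta(a,b,c)=(-q^{\frac12})^{-b}I_\Delta(b-c,a-b)=(-q^{\frac12})^{-c}I_\Delta(c-a,b-c)=(-q^{\frac12})^{-a}I_\Delta(a-b,c-a)$$ (the three expressions are known to agree; $J_\Delta$ is known to be invariant under all permutations of $a,b,c$ and to satisfy $J_\Delta(a,b,c)=(-q^{1/2})^sJ_\Delta(a+s,b+s,c+s)$ for $s\in\mathbb Z$). For $a,b,c\in\mathbb Z$, $$J^{\mathrm{FKB}}_\Delta(a,b,c)=(q)_\infty\sum_{n\ge-\min\{a,b,c\}}(-1)^n\frac{q^{\frac12n(3n+1)+n(a+b+c)+\frac12(ab+bc+ca)}}{(q;q)_{n+a}(q;q)_{n+b}(q;q)_{n+c}}.$$ *)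

(* Defs.v *)
From HB Require Import structures.
From mathcomp Require Import all_boot all_order all_algebra.
From mathcomp Require Import boolp classical_sets fsbigop.
From mathcomp Require Import zify ring.

Set Implicit Arguments.
Unset Strict Implicit.
Unset Printing Implicit Defensive.

Import Order.TTheory GRing.Theory Num.Theory.
Local Open Scope classical_set_scope.
Local Open Scope ring_scope.

Section LaurentSeries.
Variable R : comNzRingType.

Definition vanish_below (N : int) (f : int -> R) : Prop :=
  forall k : int, k < N -> f k = 0.

(* [f k] is the coefficient of the k-th power of the variable. *)
Record laurent : Type := Laurent {
  coef :> int -> R;
  coef_bounded : exists N : int, vanish_below N coef }.

HB.instance Definition _ := gen_eqMixin laurent.
HB.instance Definition _ := gen_choiceMixin laurent.

Implicit Types f g h : laurent.

Lemma laurentP f g : (forall k, f k = g k) -> f = g.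
Proof.
case: f g => [f Pf] [g Pg] /= /funext fg; rewrite fg in Pf *.
by congr Laurent; exact: Prop_irrelevance.
Qed.

Fact zero_bounded : exists N, vanish_below N (fun=> 0).
Proof. by exists 0. Qed.

Fact monom_bounded (a : R) (m : int) :
  exists N, vanish_below N (fun k => if k == m then a else 0).
Proof. by exists m => k km; rewrite (lt_eqF km). Qed.

Fact opp_bounded f : exists N, vanish_below N (fun k => - f k).
Proof. by case: (coef_bounded f) => N fN; exists N => k /fN ->; rewrite oppr0. Qed.

Fact add_bounded f g : exists N, vanish_below N (fun k => f k + g k).
Proof.
case: (coef_bounded f) (coef_bounded g) => N fN [M gM].
exists (Num.min N M) => k; rewrite lt_min => /andP[/fN -> /gM ->].
by rewrite addr0.
Qed.

(* The summand is nonzero for only finitely many [i]. *)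
Definition mul_coef (f g : int -> R) (k : int) : R :=
  \sum_(i \in [set: int]) f i * g (k - i).

Lemma mul_coef_lt N M (f g : int -> R) k :
  vanish_below N f -> vanish_below M g -> k < N + M -> mul_coef f g k = 0.
Proof.
move=> fN gM kNM; rewrite /mul_coef fsbig1 // => i _.
have [/fN ->|Ni] := ltP i N; first by rewrite mul0r.
by rewrite gM ?mulr0 //; lia.
Qed.

Lemma mul_coefE N M (f g : int -> R) (n : nat) :
  vanish_below N f -> vanish_below M g ->
  mul_coef f g (N + M + n%:Z) =
  \sum_(i < n.+1) f (N + i%:Z) * g (M + (n - i)%N%:Z).
Proof.
move=> fN gM; rewrite /mul_coef.
pose s := [seq N + i%:Z | i <- iota 0 n.+1].
have us : uniq s.
  by rewrite map_inj_uniq ?iota_uniq// => i j; lia.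
rewrite -(fsbig_widen [set` s]) //=; last first.
  move=> i [_ si] /=.
  have [/fN ->|Ni] := ltP i N; first by rewrite mul0r.
  rewrite gM ?mulr0 //.
  rewrite ltNge; apply/negP => le; apply: si => /=; apply/mapP.
  exists (absz (i - N)%R); last by lia.
  by rewrite mem_iota; lia.
rewrite -fsbig_seq // big_map -[iota 0 n.+1]/(index_iota 0 n.+1) big_mkord.
apply: eq_bigr => i _; congr (_ * g _); have := ltn_ord i; lia.
Qed.

Fact mul_bounded f g : exists N, vanish_below N (mul_coef f g).
Proof.
case: (coef_bounded f) (coef_bounded g) => N fN [M gM].
by exists (N + M) => k; exact: mul_coef_lt.
Qed.

Definition monom (a : R) (m : int) : laurent := Laurent (monom_bounded a m).
Definition zerol : laurent := Laurent zero_bounded.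
Definition onel : laurent := monom 1 0.
Definition oppl f : laurent := Laurent (opp_bounded f).
Definition addl f g : laurent := Laurent (add_bounded f g).
Definition mull f g : laurent := Laurent (mul_bounded f g).

Fact addlA : associative addl.
Proof. by move=> f g h; apply: laurentP => k; rewrite /= addrA. Qed.
Fact addlC : commutative addl.
Proof. by move=> f g; apply: laurentP => k; rewrite /= addrC. Qed.
Fact add0l : left_id zerol addl.
Proof. by move=> f; apply: laurentP => k; rewrite /= add0r. Qed.
Fact addNl : left_inverse zerol oppl addl.
Proof. by move=> f; apply: laurentP => k; rewrite /= addNr. Qed.

HB.instance Definition _ :=
  GRing.isZmodule.Build laurent addlA addlC add0l addNl.

Lemma coefD f g k : (f + g) k = f k + g k. Proof. by []. Qed.
Lemma coefN f k : (- f) k = - f k. Proof. by []. Qed.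

Let window (N : int) (f : int -> R) (n : nat) : {poly R} :=
  \poly_(i < n.+1) f (N + i%:Z).

Let mul_window N M (f g : int -> R) (n m : nat) :
  vanish_below N f -> vanish_below M g -> (m <= n)%N ->
  mul_coef f g (N + M + m%:Z) = (window N f n * window M g n)`_m.
Proof.
move=> fN gM mn; rewrite (mul_coefE _ fN gM) coefM; apply: eq_bigr => i _.
by rewrite !coef_poly !ifT //; have := ltn_ord i; lia.
Qed.

Let coefM_eq (p p' r r' : {poly R}) n :
  (forall i, (i <= n)%N -> p`_i = p'`_i) ->
  (forall i, (i <= n)%N -> r`_i = r'`_i) -> (p * r)`_n = (p' * r')`_n.
Proof.
move=> pp rr; rewrite !coefM; apply: eq_bigr => i _.
by rewrite pp ?rr //; have := ltn_ord i; lia.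
Qed.

Fact mullC : commutative mull.
Proof.
move=> f g; apply: laurentP => k /=.
case: (coef_bounded f) (coef_bounded g) => N fN [M gM].
have [kl|kg] := ltP k (N + M).
  by rewrite (mul_coef_lt fN gM) // (mul_coef_lt gM fN) //; lia.
have -> : k = N + M + (absz (k - N - M)%R)%:Z by lia.
by rewrite (mul_window fN gM (leqnn _)) mulrC (addrC N M)
  (mul_window gM fN (leqnn _)).
Qed.

Fact mullA : associative mull.
Proof.
move=> f g h; apply: laurentP => k /=.
case: (coef_bounded f) (coef_bounded g) (coef_bounded h) => N fN [M gM] [P hP].
have fgL : vanish_below (N + M) (mull f g) by move=> j; exact: mul_coef_lt.
have ghL : vanish_below (M + P) (mull g h) by move=> j; exact: mul_coef_lt.
have [kl|kg] := ltP k (N + M + P).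
  by rewrite (mul_coef_lt fN ghL) ?(mul_coef_lt fgL hP) //; lia.
pose n := absz (k - N - M - P)%R.
have kE : k = N + M + P + n%:Z by rewrite /n; lia.
have kE' : k = N + (M + P) + n%:Z by rewrite /n; lia.
rewrite {1}kE' kE (mul_window fN ghL (leqnn _)) (mul_window fgL hP (leqnn _)).
transitivity (window N f n * (window M g n * window P h n))`_n; last rewrite mulrA.
  apply: coefM_eq => // i ile; rewrite coef_poly ltnS ile.
  exact: mul_window.
apply: coefM_eq => // i ile; rewrite [RHS]coef_poly ltnS ile; apply/esym.
exact: mul_window.
Qed.

Fact monom_vanish a m : vanish_below m (monom a m).
Proof. by move=> k km /=; rewrite (lt_eqF km). Qed.

Lemma coef_monomM a m f k : mull (monom a m) f k = a * f (k - m).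
Proof.
case: (coef_bounded f) => N fN /=.
have [kl|kg] := ltP k (m + N).
  rewrite (mul_coef_lt (@monom_vanish a m) fN kl) fN ?mulr0 //; lia.
have kE : k = m + N + (absz (k - m - N)%R)%:Z by lia.
rewrite kE (mul_coefE _ (@monom_vanish a m) fN) /= big_ord_recl /=.
rewrite addr0 eqxx big1 ?addr0; first by congr (_ * f _); lia.
by move=> i _; rewrite ifF ?mul0r //; apply/eqP; rewrite /bump /=; lia.
Qed.

Fact mul1l : left_id onel mull.
Proof. by move=> f; apply: laurentP => k; rewrite coef_monomM mul1r subr0. Qed.

Fact mullDl : left_distributive mull addl.
Proof.
move=> f g h; apply: laurentP => k.
case: (coef_bounded f) (coef_bounded g) (coef_bounded h) => N fN [M gM] [P hP].
pose L := Num.min N M.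
have fL : vanish_below L f by move=> j jL; apply: fN; lia.
have gL : vanish_below L g by move=> j jL; apply: gM; lia.
have fgL : vanish_below L (addl f g) by move=> j jL /=; rewrite fL ?gL ?addr0.
rewrite /=; have [kl|kg] := ltP k (L + P).
  by rewrite (mul_coef_lt fgL hP) ?(mul_coef_lt fL hP) ?(mul_coef_lt gL hP) ?addr0.
have -> : k = L + P + (absz (k - L - P)%R)%:Z by lia.
rewrite (mul_coefE _ fL hP) (mul_coefE _ gL hP) (mul_coefE _ fgL hP) -big_split.
by apply: eq_bigr => i _; rewrite /= mulrDl.
Qed.

Fact onel_neq0 : onel != 0.
Proof.
apply/eqP => /(congr1 (fun f => coef f 0)) /= /eqP.
by rewrite oner_eq0.
Qed.

HB.instance Definition _ :=
  GRing.Zmodule_isComNzRing.Build laurent mullA mullC mul1l mullDl onel_neq0.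

Definition unitl : pred laurent := fun f => `[< exists g, g * f = 1 >].
Definition invl f : laurent := xget f [set g | g * f = 1].

Fact mulVl : {in unitl, left_inverse 1 invl *%R}.
Proof. by move=> f /asboolP ex; rewrite /invl; exact: (xgetPex f ex). Qed.
Fact unitlP : forall f g, g * f = 1 -> unitl f.
Proof. by move=> f g gf; apply/asboolP; exists g. Qed.
Fact invl_out : {in [predC unitl], invl =1 id}.
Proof.
move=> f /negP nu; rewrite /invl; case: xgetP => // g _ gf.
by case: nu; exact: (unitlP gf).
Qed.

HB.instance Definition _ :=
  GRing.ComNzRing_hasMulInverse.Build laurent mulVl unitlP invl_out.

(* Convergence in the topology defined by the order of vanishing. *)
Definition laurent_cvg (u : nat -> laurent) (l : laurent) : Prop :=
  forall K : int, exists N : nat,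
    forall n : nat, (N <= n)%N -> forall k : int, k < K -> u n k = l k.

(* Defaults to 0 if [u] diverges. *)
Definition laurent_lim (u : nat -> laurent) : laurent :=
  xget 0 [set l | laurent_cvg u l].

Definition laurent_sum (n0 : int) (F : int -> laurent) : laurent :=
  laurent_lim (fun N => \sum_(i < N) F (n0 + i%:Z)).

Lemma laurent_cvg_unique u l l' : laurent_cvg u l -> laurent_cvg u l' -> l = l'.
Proof.
move=> ul ul'; apply: laurentP => k.
case: (ul (k + 1)) (ul' (k + 1)) => N uN [M uM].
by rewrite -(uN (maxn N M)) ?(uM (maxn N M)) ?leq_maxl ?leq_maxr //; lia.
Qed.

Lemma laurent_limE u l : laurent_cvg u l -> laurent_lim u = l.
Proof.
by move=> ul; apply: xget_unique => // l' ul'; exact: laurent_cvg_unique ul.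
Qed.

Lemma laurent_limP u : (exists l, laurent_cvg u l) -> laurent_cvg u (laurent_lim u).
Proof. by case=> l ul; rewrite (laurent_limE ul). Qed.

Lemma laurent_complete (u : nat -> laurent) :
  (forall K : int, exists N : nat,
     forall n, (N <= n)%N -> vanish_below K (u n.+1 - u n)) ->
  exists l, laurent_cvg u l.
Proof.
move=> uC; have [N uN] := choice uC.
have uE K n : (N K <= n)%N -> forall k, k < K -> u n k = u (N K) k.
  elim: n => [|n IH]; first by rewrite leqn0 => /eqP ->.
  rewrite leq_eqVlt => /orP[/eqP -> //|Nn] k kK; rewrite -IH //.
  by apply/eqP; rewrite -subr_eq0; apply/eqP; exact: (uN K n Nn k kK).
pose c k := u (N (k + 1)) k.
have cE K n k : (N K <= n)%N -> k < K -> u n k = c k.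
  move=> Nn kK; rewrite (uE K n Nn k kK) /c.
  rewrite -(uE K (maxn (N K) (N (k + 1)))) ?leq_maxl //.
  by rewrite (uE (k + 1)) ?leq_maxr //; lia.
have bc : exists M, vanish_below M c.
  case: (coef_bounded (u (N 0))) => M uM; exists (Num.min 0 M) => k kM.
  by rewrite -(cE 0 (N 0)) ?uM //; lia.
by exists (Laurent bc) => K; exists (N K) => n Nn k kK; exact: cE kK.
Qed.

Lemma laurent_sum_cvg n0 (F : int -> laurent) :
  (forall K : int, exists N : nat,
     forall i, (N <= i)%N -> vanish_below K (F (n0 + i%:Z))) ->
  exists l, laurent_cvg (fun N => \sum_(i < N) F (n0 + i%:Z)) l.
Proof.
move=> FC; apply: laurent_complete => K; case: (FC K) => N FN; exists N => n Nn.
by rewrite big_ord_recr addrAC subrr add0r; exact: FN.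
Qed.

Lemma vanishM N M f g :
  vanish_below N f -> vanish_below M g -> vanish_below (N + M) (f * g).
Proof. by move=> fN gM k; exact: mul_coef_lt. Qed.

Lemma vanishW N M f : M <= N -> vanish_below N f -> vanish_below M f.
Proof. by move=> MN fN k kM; apply: fN; exact: lt_le_trans MN. Qed.

Lemma vanishX f n : vanish_below 1 f -> vanish_below n%:Z (f ^+ n).
Proof.
move=> f1; elim: n => [|n IH].
  by rewrite expr0; exact: monom_vanish.
by rewrite exprS -add1n PoszD; exact: vanishM.
Qed.

(* A power series with constant term 1 is a unit of the ring of power series. *)
Lemma power_series_unit h : vanish_below 1 h ->
  (1 - h \is a GRing.unit) /\ vanish_below 0 (1 - h)^-1.
Proof.
move=> h1; pose u N := \sum_(i < N) h ^+ i.
have [g ug] : exists g, laurent_cvg u g.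
  apply: laurent_complete => K; exists (absz K) => n Kn.
  rewrite /u big_ord_recr addrAC subrr add0r.
  by apply: (vanishW _ (vanishX (n := n) h1)); lia.
have u0 n : vanish_below 0 (u n).
  rewrite /u; elim: n => [|n IH] k k0; first by rewrite big_ord0.
  rewrite big_ord_recr /= IH // add0r.
  by apply: (vanishX (n:=n) h1); apply: lt_le_trans k0 _.
have g0 : vanish_below 0 g.
  by move=> k k0; case: (ug 0) => N uN; rewrite -(uN N) // u0.
have gh : g * (1 - h) = 1.
  apply: laurentP => k; case: (ug (k + 1)) => N uN.
  pose n := maxn N (absz (k + 1)%R).
  have ungK : vanish_below (k + 1) (g - u n).
    by move=> j jk /=; rewrite -(uN n) ?leq_maxl // subrr.
  have h0 : vanish_below 0 (1 - h).
    move=> j j0 /=; rewrite h1; last exact: lt_trans j0 _.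
    by rewrite (lt_eqF j0) subrr.
  have -> : g * (1 - h) = (g - u n) * (1 - h) - h ^+ n + 1.
    have un : u n * (1 - h) = 1 - h ^+ n.
      by rewrite mulrC /u -opprB -[1 - h ^+ n]opprB subrX1 mulNr.
    by rewrite mulrBl un; ring.
  have := vanishM ungK h0; rewrite addr0 => /(_ k) gu.
  rewrite !coefD coefN gu ?(vanishX (n:=n) h1) ?subrr ?add0r //; rewrite /n; lia.
have uh : 1 - h \is a GRing.unit by apply/unitrPr; exists g; rewrite mulrC.
by split => //; rewrite (_ : _^-1 = g) //; apply: (mulIr uh); rewrite mulVr // gh.
Qed.

End LaurentSeries.

Definition qhalf : laurent int := monom 1 1.
Definition q : laurent int := qhalf ^+ 2.

Definition qpoch (n : nat) : laurent int := \prod_(1 <= j < n.+1) (1 - q ^+ j).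

Definition qpoch_inf : laurent int := laurent_lim qpoch.

(* 1/(q)_n, which is 0 by convention when n < 0. *)
Definition qpoch_inv (n : int) : laurent int :=
  match n with Posz m => (qpoch m)^-1 | Negz _ => 0 end.

(* In the two summands below, the exponents of q are doubled to become integral
   exponents of [qhalf]. *)

Definition tet_index_term (m e n : int) : laurent int :=
  (-1) ^ n * qhalf ^ (n * (n + 1) - (2 * n + e) * m)
    * qpoch_inv n * qpoch_inv (n + e).

Definition tet_index (m e : int) : laurent int :=
  laurent_sum (Num.max 0 (- e)) (tet_index_term m e).

(* The two cyclic rotations of this formula define the same series; the first
   one is taken as the definition. *)
Definition J_tet (a b c : int) : laurent int :=
  (- qhalf) ^ (- b) * tet_index (b - c) (a - b).

Definition J_FKB_term (a b c n : int) : laurent int :=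
  (-1) ^ n
    * qhalf ^ (n * (3 * n + 1) + 2 * n * (a + b + c) + (a * b + b * c + c * a))
    * qpoch_inv (n + a) * qpoch_inv (n + b) * qpoch_inv (n + c).

Definition J_FKB (a b c : int) : laurent int :=
  qpoch_inf * laurent_sum (- Num.min a (Num.min b c)) (J_FKB_term a b c).

(* No junk value is involved: the inverses above are inverses of units, and the
   infinite product and both sums converge. *)

Lemma qhalf_exp (m : int) : qhalf ^ m = monom 1 m.
Proof.
have qn (n : nat) : qhalf ^+ n = monom 1 n%:Z.
  elim: n => [|n IH]; first by rewrite expr0.
  rewrite exprS IH; apply: laurentP => k; rewrite [LHS]coef_monomM mul1r /=.
  by congr (if _ then _ else _); lia.
have mV (n : int) : monom 1 (- n) * monom 1 n = 1 :> laurent int.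
  apply: laurentP => k; rewrite [LHS]coef_monomM mul1r /=.
  by congr (if _ then _ else _); lia.
case: m => n; first by rewrite -exprnP qn.
rewrite NegzE -exprnN qn; apply: (mulIr (_ : monom 1 n.+1%:Z \is a GRing.unit)).
  by apply/unitrPr; exists (monom 1 (- n.+1%:Z)); rewrite mulrC mV.
rewrite mulVr ?mV //.
by apply/unitrPr; exists (monom 1 (- n.+1%:Z)); rewrite mulrC mV.
Qed.

Lemma qhalf_unit : qhalf \is a GRing.unit.
Proof.
apply/unitrPr; exists (qhalf ^ (-1)); rewrite !qhalf_exp; apply: laurentP => k.
by rewrite [LHS]coef_monomM mul1r /=; congr (if _ then _ else _); lia.
Qed.

Lemma q_vanish (j : nat) : vanish_below (2 * j%:Z) (q ^+ j).
Proof.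
rewrite /q -exprM exprnP qhalf_exp PoszM; exact: monom_vanish.
Qed.

Lemma qpochS n : qpoch n.+1 = qpoch n * (1 - q ^+ n.+1).
Proof. by rewrite /qpoch big_nat_recr. Qed.

Lemma qfactor_unit (j : nat) :
  (1 - q ^+ j.+1 \is a GRing.unit) /\ vanish_below 0 (1 - q ^+ j.+1)^-1.
Proof. by apply: power_series_unit; apply: vanishW (@q_vanish j.+1); lia. Qed.

Lemma qpoch_unit n : qpoch n \is a GRing.unit.
Proof.
elim: n => [|n IH]; first by rewrite /qpoch big_geq // unitr1.
by rewrite qpochS unitrM IH; case: (qfactor_unit n) => ->.
Qed.

Lemma qpoch_inv_vanish n : vanish_below 0 (qpoch_inv n).
Proof.
case: n => [n|//]; rewrite /qpoch_inv.
elim: n => [|n IH]; first by rewrite /qpoch big_geq // invr1; exact: monom_vanish.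
rewrite qpochS invrM ?qpoch_unit //; last by case: (qfactor_unit n).
by rewrite -[0]addr0; apply: vanishM => //; case: (qfactor_unit n).
Qed.

Lemma qpoch_cvg : laurent_cvg qpoch qpoch_inf.
Proof.
apply: laurent_limP; apply: laurent_complete => K; exists (absz K) => n Kn.
have q0 m : vanish_below 0 (qpoch m).
  elim: m => [|m IH]; first by rewrite /qpoch big_geq //; exact: monom_vanish.
  rewrite qpochS mulrBr mulr1 => k k0; rewrite coefD coefN IH // add0r.
  have := vanishM IH (@q_vanish m.+1); move=> /(_ k) ->; rewrite ?oppr0 //; lia.
rewrite qpochS mulrBr mulr1 addrAC subrr add0r => k kK; rewrite coefN.
have := vanishM (q0 n) (@q_vanish n.+1); move=> /(_ k) ->; rewrite ?oppr0 //; lia.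
Qed.

Lemma sign_vanish (n : int) : vanish_below 0 ((-1) ^ n : laurent int).
Proof.
have s (b : nat) : vanish_below 0 ((-1) ^+ b : laurent int).
  rewrite -signr_odd => k k0; case: (odd b); rewrite ?expr1 ?expr0 /=;
  by rewrite (lt_eqF k0) ?oppr0.
case: n => n; first exact: s.
by rewrite NegzE -exprnN -exprVn invrN1; exact: s.
Qed.

Lemma tet_index_cvg m e :
  exists l, laurent_cvg
    (fun N => \sum_(i < N) tet_index_term m e (Num.max 0 (- e) + i%:Z)) l.
Proof.
apply: laurent_sum_cvg => K.
exists (`|K| + 2 * `|m| + `|e| * `|m|)%N => i Ni.
set n := _ + _; pose d := n * (n + 1) - (2 * n + e) * m.
have dv : vanish_below (0 + d + 0 + 0) (tet_index_term m e n).
  apply: vanishM _ (@qpoch_inv_vanish _); apply: vanishM _ (@qpoch_inv_vanish _).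
  by apply: vanishM; rewrite ?qhalf_exp; [exact: sign_vanish|exact: monom_vanish].
apply: vanishW dv; rewrite !addr0 add0r /d.
have ni : i%:Z <= n by rewrite /n; lia.
have nB : `|K| + 2 * `|m| + `|e| * `|m| <= n by lia.
have em : e * m <= `|e| * `|m| by rewrite -normrM ler_norm.
have mm : m <= `|m| by exact: ler_norm.
have KK : K <= `|K| by exact: ler_norm.
have ? : 0 <= `|e| * `|m| by rewrite mulr_ge0.
have ? : 0 <= `|m| by []. have ? : 0 <= `|K| by [].
nia.
Qed.

Lemma J_FKB_cvg a b c :
  exists l, laurent_cvg
    (fun N => \sum_(i < N)
       J_FKB_term a b c (- Num.min a (Num.min b c) + i%:Z)) l.
Proof.
apply: laurent_sum_cvg => K.
pose s := a + b + c; pose t := a * b + b * c + c * a.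
set n0 := - _.
exists (`|K| + 2 * `|s| + `|t| + `|n0|)%N => i Ni.
set n := _ + _; pose d := n * (3 * n + 1) + 2 * n * s + t.
have dv : vanish_below (0 + d + 0 + 0 + 0) (J_FKB_term a b c n).
  do 3 apply: vanishM _ (@qpoch_inv_vanish _).
  by apply: vanishM; rewrite ?qhalf_exp; [exact: sign_vanish|exact: monom_vanish].
apply: vanishW dv; rewrite !addr0 add0r /d.
have nB : `|K| + 2 * `|s| + `|t| <= n by rewrite /n; lia.
move: (ler_norm K) (ler_norm (-s)) (ler_norm (-t)); rewrite !normrN.
have ? : 0 <= `|s| by []. have ? : 0 <= `|K| by []. have ? : 0 <= `|t| by [].
move=> *; nia.
Qed.

(* Main.v *)
Require Import Defs.
From mathcomp Require Import all_boot all_order all_algebra.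
From mathcomp Require Import zify ring.

(** Euler's expansion
      (q)_oo / (q)_m = sum_(k >= 0) (-1)^k q^(k(k+1)/2 + km) / (q)_k
    holds for every integer m: the right-hand side E(m) satisfies
    E(m - 1) = (1 - q^m) E(m) and tends to 1 as m -> +oo.  Inserting it with
    m = n + c in the sum defining J_FKB and setting N = n + k gives a double sum
    over (n, N), in which the quadratic part n^2 + N^2/2 of the exponent is
    positive definite, so that the two summations can be exchanged.  For fixed N the sum over n is
    the q-Vandermonde sum
      sum_i q^(i(i+e)) / ((q)_i (q)_(i+e) (q)_(M-i)) = 1 / ((q)_M (q)_(M+e))
    with i = n + a, M = N + a, e = b - a, and what remains is the series of J_tet
    with summation index N + b.  All sums are started at n = -a, the extra
    terms being zero. *)

Set Implicit Arguments.
Unset Strict Implicit.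
Unset Printing Implicit Defensive.

Import Order.TTheory GRing.Theory Num.Theory.
Local Open Scope ring_scope.

(** * Limits and iterated sums of Laurent series *)

Section Convergence.
Variable R : comNzRingType.
Implicit Types (f g l : laurent R) (u v : nat -> laurent R).

Lemma vanishD K f g :
  vanish_below K f -> vanish_below K g -> vanish_below K (f + g).
Proof. by move=> fK gK k kK; rewrite Defs.coefD fK ?gK ?addr0. Qed.

Lemma vanishN K f : vanish_below K f -> vanish_below K (- f).
Proof. by move=> fK k kK; rewrite Defs.coefN fK ?oppr0. Qed.

Lemma vanish_sum K (I : Type) (r : seq I) (P : pred I) (F : I -> laurent R) :
  (forall i, P i -> vanish_below K (F i)) ->
  vanish_below K (\sum_(i <- r | P i) F i).
Proof. by move=> FK; elim/big_ind: _ => //; exact: vanishD. Qed.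

Lemma laurent_cvgP u l :
  laurent_cvg u l <->
  forall K, exists N, forall n, (N <= n)%N -> vanish_below K (u n - l).
Proof.
split=> ul K; have [N uN] := ul K; exists N => n Nn k kK.
  by rewrite Defs.coefD Defs.coefN uN ?subrr.
by apply/eqP; rewrite -subr_eq0; apply/eqP; exact: uN kK.
Qed.

Lemma laurent_cvg_cst l : laurent_cvg (fun=> l) l.
Proof. by move=> K; exists 0%N. Qed.

Lemma laurent_cvgD u v l l' :
  laurent_cvg u l -> laurent_cvg v l' ->
  laurent_cvg (fun n => u n + v n) (l + l').
Proof.
move=> ul vl K; have [N uN] := ul K; have [M vM] := vl K.
exists (maxn N M) => n; rewrite geq_max => /andP[Nn Mn] k kK.
by rewrite !Defs.coefD uN ?vM.
Qed.

Lemma laurent_cvgMl f u l :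
  laurent_cvg u l -> laurent_cvg (fun n => f * u n) (f * l).
Proof.
move=> /laurent_cvgP ul; apply/laurent_cvgP => K.
have [M fM] := coef_bounded f; have [N uN] := ul (K - M).
exists N => n Nn; rewrite -mulrBr.
by have := vanishM fM (uN n Nn); rewrite addrC subrK.
Qed.

Lemma laurent_cvgS u l : laurent_cvg u l -> laurent_cvg (fun n => u n.+1) l.
Proof.
move=> ul K; have [N uN] := ul K; exists N => n Nn.
by apply: uN; exact: leqW.
Qed.

Lemma vanish_lim K u l :
  (forall n, vanish_below K (u n)) -> laurent_cvg u l -> vanish_below K l.
Proof. by move=> uK ul k kK; have [N uN] := ul K; rewrite -(uN N) ?uK. Qed.

(** Allows series with different natural starting points to be summed from a common one: the
    [d = n0 - n1] added terms are zero, so partial sums are only delayed by [d]. *)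
Lemma laurent_cvg_start (n0 n1 : int) (F : int -> laurent R) l :
  n1 <= n0 -> (forall n, n < n0 -> F n = 0) ->
  laurent_cvg (fun N => \sum_(i < N) F (n0 + i%:Z)) l ->
  laurent_cvg (fun N => \sum_(i < N) F (n1 + i%:Z)) l.
Proof.
move=> n10 F0 Fl K; have [N FN] := Fl K.
pose d := absz (n0 - n1)%R; exists (d + N)%N => n Nn k kK.
rewrite -(FN (n - d)%N _ k kK); last by lia.
rewrite -(subnKC (_ : d <= n)%N); last by lia.
rewrite addKn big_split_ord /= big1 ?add0r; last first.
  by move=> i _; apply: F0; have := ltn_ord i; rewrite /d; lia.
have -> // : \sum_(i < n - d) F (n1 + (d + i)%N%:Z)
           = \sum_(i < n - d) F (n0 + i%:Z).
by apply: eq_bigr => i _; congr F; rewrite /d; lia.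
Qed.

(** Off the square of side [L] all entries vanish below order [K], so truncating the rows at
    [n >= L] alters nothing below [K]. Square sums are symmetric, so using this for [T] and its
    transpose exchanges the summations. *)
Lemma laurent_cvg_rows (T : nat -> nat -> laurent R) (f : nat -> laurent R) l :
  (forall K, exists L, forall i j, (L <= maxn i j)%N -> vanish_below K (T i j)) ->
  (forall i, laurent_cvg (fun N => \sum_(j < N) T i j) (f i)) ->
  laurent_cvg (fun N => \sum_(i < N) f i) l <->
  laurent_cvg (fun N => \sum_(i < N) \sum_(j < N) T i j) l.
Proof.
move=> TK Tf.
suff fT K : exists L, forall n, (L <= n)%N ->
    vanish_below K (\sum_(i < n) f i - \sum_(i < n) \sum_(j < n) T i j).
  split=> ul K; have [L fL] := fT K; have [N uN] := ul K;
  exists (maxn L N) => n; rewrite geq_max => /andP[Ln Nn] k kK;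
  rewrite -(uN n) //; last (apply/esym);
  by apply/eqP; rewrite eq_sym -subr_eq0; apply/eqP; exact: fL.
have [L TL] := TK K; exists L => n Ln; rewrite -sumrB.
apply: vanish_sum => i _ k kK; have [N fN] := Tf i K.
(* The row limit is replaced by a partial sum of length at least [n]; the difference is a finite sum
   over [j >= n >= L]. *)
rewrite Defs.coefD Defs.coefN -(fN (maxn n N)) ?leq_maxr //.
rewrite -(subnKC (leq_maxl n N)) big_split_ord Defs.coefD addrAC subrr add0r.
apply: (vanish_sum (K := K)) => // j _; apply: TL.
by rewrite leq_max; apply/orP; right; rewrite /=; lia.
Qed.

End Convergence.

(** * Powers of q^(1/2) and reciprocals of (q)_n *)

Lemma qhalfD m n : qhalf ^ (m + n) = qhalf ^ m * qhalf ^ n.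
Proof. by rewrite exprzDr // qhalf_unit. Qed.

Lemma signD (m n : int) :
  (-1) ^ (m + n) = (-1) ^ m * (-1) ^ n :> laurent int.
Proof. by rewrite exprzDr // unitrN1. Qed.

Lemma qE (n : nat) : q ^+ n = qhalf ^ (2 * n%:Z).
Proof. by rewrite /q -exprM exprnP PoszM. Qed.

Lemma qpoch_inv_lt0 n : n < 0 -> qpoch_inv n = 0.
Proof. by case: n. Qed.

Lemma qpoch_invB1 n : qpoch_inv (n - 1) = (1 - qhalf ^ (2 * n)) * qpoch_inv n.
Proof.
case: n => [[|n]|n]; last by rewrite mulr0 qpoch_inv_lt0.
  by rewrite mulr0 expr0z subrr mul0r.
rewrite -qE (_ : _ - 1 = n%:Z) /=; last by lia.
rewrite qpochS invrM ?qpoch_unit //; last by case: (qfactor_unit n).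
by rewrite mulrA divrr ?mul1r //; case: (qfactor_unit n).
Qed.

Lemma vanish_qhalf m : vanish_below m (qhalf ^ m).
Proof. by rewrite qhalf_exp; exact: monom_vanish. Qed.

Lemma vanish_monomial m (n : int) :
  vanish_below m ((-1) ^ n * qhalf ^ m : laurent int).
Proof.
by rewrite -[m in vanish_below m]add0r;
  apply: vanishM; [exact: sign_vanish|exact: vanish_qhalf].
Qed.

Lemma vanishMqpoch_inv K (f : laurent int) n :
  vanish_below K f -> vanish_below K (f * qpoch_inv n).
Proof.
by move=> fK; rewrite -[K]addr0; apply: vanishM => //; exact: qpoch_inv_vanish.
Qed.

(** * The q-Vandermonde sum *)

Definition vandermonde_term (M e i : int) : laurent int :=
  qhalf ^ (2 * (i * (i + e))) * qpoch_inv i * qpoch_inv (i + e)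
    * qpoch_inv (M - i).

(** Split 1 - q^(M+1) = (1 - q^(M+1-i)) + q^(M+1-i) (1 - q^i); each bracket lowers the index of one
    reciprocal by one. *)
Lemma vandermonde_recl (M e i : int) :
  (1 - qhalf ^ (2 * (M + 1))) * vandermonde_term (M + 1) e i =
  vandermonde_term M e i
    + qhalf ^ (2 * (M + 1 + e)) * vandermonde_term M (e + 1) (i - 1).
Proof.
rewrite /vandermonde_term.
have -> : M - i = M + 1 - i - 1 by ring.
have -> : M - (i - 1) = M + 1 - i by ring.
have -> : i - 1 + (e + 1) = i + e by ring.
rewrite !qpoch_invB1.
have -> : 2 * (M + 1) = 2 * (M + 1 - i) + 2 * i by ring.
have -> : 2 * (i * (i + e)) = 2 * ((i - 1) * (i + e)) + 2 * i + 2 * e by ring.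
have -> : 2 * (M + 1 + e) = 2 * (M + 1 - i) + 2 * i + 2 * e by ring.
by rewrite !qhalfD; ring.
Qed.

(* The upper bound [n] is free: the terms with [i > M] are zero.  This lets the
   induction change [M] and [e] without adjusting the range of summation. *)
Lemma q_vandermonde (M e : int) (n : nat) : M < n%:Z ->
  \sum_(i < n) vandermonde_term M e i%:Z = qpoch_inv M * qpoch_inv (M + e).
Proof.
case: M => [M|M] Mn; last first.
  rewrite mul0r big1 // => i _.
  by rewrite /vandermonde_term (@qpoch_inv_lt0 (_ - _)) ?mulr0 //; lia.
elim: M e n Mn => [|M IH] e [//|n] Mn.
  rewrite big_ord_recl big1 ?addr0 => [|i _]; last first.
    by rewrite /vandermonde_term (@qpoch_inv_lt0 (_ - _)) ?mulr0 //=; lia.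
  rewrite /vandermonde_term mul0r mulr0 expr0z mul1r subr0 !add0r.
  by rewrite /= [qpoch 0]big_geq // invr1 mulr1 mul1r.
have -> : M.+1%:Z = M%:Z + 1 by lia.
have [U _] := qfactor_unit M.
apply: (mulrI U); rewrite qE (_ : M.+1%:Z = M%:Z + 1); last by lia.
rewrite mulrA -qpoch_invB1 addrK mulr_sumr.
under eq_bigr do rewrite vandermonde_recl.
rewrite big_split IH ?ltz_nat //=; last by lia.
(* In the second sum the term [i = 0] contains 1/(q)_(-1) = 0; the others are reindexed by
   [i - 1]. *)
rewrite -mulr_sumr big_ord_recl {1}/vandermonde_term sub0r.
rewrite (@qpoch_inv_lt0 (- 1)) // mulr0 !mul0r add0r.
have sh (i : 'I_n) : (lift ord0 i)%:Z - 1 = i%:Z by rewrite /= /bump /=; lia.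
under eq_bigr => i _ do rewrite sh.
rewrite IH; last by lia.
(* What remains is (1 - q^(M+1+e)) + q^(M+1+e) = 1. *)
have -> : M%:Z + e = M%:Z + 1 + e - 1 by ring.
rewrite qpoch_invB1 (_ : M%:Z + (e + 1) = M%:Z + 1 + e); last by ring.
rewrite -[qpoch_inv M%:Z]/((qpoch M)^-1); ring.
Qed.

(** * Euler's expansion *)

Definition euler_term (m k : int) : laurent int :=
  (-1) ^ k * qhalf ^ (k * (k + 1) + 2 * k * m) * qpoch_inv k.

Definition euler_sum m := laurent_lim (fun N => \sum_(k < N) euler_term m k%:Z).

Lemma euler_cvg m :
  laurent_cvg (fun N => \sum_(k < N) euler_term m k%:Z) (euler_sum m).
Proof.
apply: laurent_limP; apply: laurent_complete => K.
exists (`|K| + 2 * `|m|)%N => k Nk; rewrite big_ord_recr addrAC subrr add0r.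
apply: vanishMqpoch_inv; apply: vanishW (@vanish_monomial _ _).
have : `|K| + 2 * `|m| <= k%:Z by lia.
move: (ler_norm K) (ler_norm (- m)); rewrite normrN /=.
have : 0 <= `|m| by []. have : 0 <= `|K| by [].
nia.
Qed.

(** Lowering m multiplies the term by q^(-k) = 1 + q^(-k) (1 - q^k), and 1 - q^k turns 1/(q)_k into
    1/(q)_(k-1). *)
Lemma euler_term_shift m k :
  euler_term (m - 1) k = euler_term m k - qhalf ^ (2 * m) * euler_term m (k - 1).
Proof.
rewrite /euler_term qpoch_invB1 subrK.
have -> : (-1) ^ k = (-1) ^ (k - 1) * (-1) :> laurent int.
  by rewrite -{1}[k](subrK 1) (signD (k - 1) 1) expr1z.
have -> : k * (k + 1) + 2 * k * m =
  (k - 1) * k + 2 * (k - 1) * m + 2 * k + 2 * m by ring.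
have -> : k * (k + 1) + 2 * k * (m - 1) =
  (k - 1) * k + 2 * (k - 1) * m + 2 * m by ring.
by rewrite !qhalfD; ring.
Qed.

Lemma euler_sumB1 m : euler_sum (m - 1) = (1 - qhalf ^ (2 * m)) * euler_sum m.
Proof.
(* The shift from k to k - 1 costs one term, so [N.+1] terms are matched with [N] terms of the
   subtracted series. *)
apply: (laurent_cvg_unique (laurent_cvgS (euler_cvg (m - 1)))).
rewrite mulrBl mul1r -mulNr.
have := laurent_cvgD (laurent_cvgS (euler_cvg m))
  (laurent_cvgMl (- qhalf ^ (2 * m)) (euler_cvg m)).
congr laurent_cvg; apply/boolp.funext => N /=.
have e0 : euler_term m ((ord0 : 'I_N.+1)%:Z - 1) = 0.
  by rewrite /euler_term qpoch_inv_lt0 ?mulr0.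
under [RHS]eq_bigr do rewrite euler_term_shift.
rewrite sumrB -mulr_sumr [X in _ = _ - _ * X]big_ord_recl.
rewrite e0 add0r mulNr.
congr (_ - _ * _); apply: eq_bigr => i _.
by congr euler_term; rewrite /= /bump /=; lia.
Qed.

Lemma euler_term0 m : euler_term m 0 = 1.
Proof.
rewrite /euler_term mulr0 !mul0r addr0 !expr0z !mul1r.
by rewrite /= [qpoch 0]big_geq // invr1.
Qed.

Lemma vanish_euler_sum (m : nat) : vanish_below (2 * m%:Z) (euler_sum m%:Z - 1).
Proof.
apply: (@vanish_lim _ _ (fun N => \sum_(k < N.+1) euler_term m k%:Z - 1)).
  move=> N; rewrite big_ord_recl (euler_term0 m) addrAC subrr add0r.
  apply: vanish_sum => k _; apply: vanishMqpoch_inv.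
  apply: vanishW (@vanish_monomial _ _); rewrite lift0 intS.
  have : 0 <= k%:Z * m%:Z by []. have : 0 <= k%:Z * k%:Z by [].
  nia.
by apply: laurent_cvgD; [exact: laurent_cvgS (euler_cvg m)|exact: laurent_cvg_cst].
Qed.

Lemma vanish_qpoch n : vanish_below 0 (qpoch n).
Proof.
elim: n => [|n IH]; first by rewrite /qpoch big_geq //; exact: monom_vanish.
rewrite qpochS -[0]addr0; apply: vanishM => //.
apply: vanishD; first exact: monom_vanish.
by apply: vanishN; apply: vanishW (@q_vanish _).
Qed.

Lemma euler_sum_nat (m : nat) : qpoch m * euler_sum m%:Z = euler_sum 0.
Proof.
elim: m => [|m <-]; first by rewrite /qpoch big_geq // mul1r.
rewrite qpochS -mulrA qE -euler_sumB1; congr (_ * euler_sum _); lia.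
Qed.

Lemma euler_sum0 : euler_sum 0 = qpoch_inf.
Proof.
apply: (@laurent_cvg_unique _ (fun m => qpoch m * euler_sum m%:Z)).
  under boolp.eq_fun do rewrite euler_sum_nat.
  exact: laurent_cvg_cst.
(* Write (q)_m E(m) = (q)_m + (q)_m (E(m) - 1); the last product has order at least 2m in
   q^(1/2). *)
under boolp.eq_fun => m do
  rewrite -[euler_sum _](subrK 1) mulrDr mulr1 addrC.
rewrite -[qpoch_inf]addr0; apply: laurent_cvgD; first exact: qpoch_cvg.
apply/laurent_cvgP => K; exists `|K|%N => n Kn; rewrite subr0.
apply: vanishW (vanishM (@vanish_qpoch n) (@vanish_euler_sum n)); lia.
Qed.

Lemma euler_sumE m : euler_sum m = qpoch_inf * qpoch_inv m.
Proof.
case: m => m.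
  by rewrite -euler_sum0 -(euler_sum_nat m) mulrAC divrr ?qpoch_unit ?mul1r.
(* The factor 1 - q^0 gives E(-1) = 0, and the recurrence carries this down to all negative m. *)
rewrite mulr0 NegzE; elim: m => [|m IH].
  by rewrite -[- _]add0r euler_sumB1 mulr0 expr0z subrr mul0r.
by rewrite (_ : - m.+2%:Z = - m.+1%:Z - 1) ?euler_sumB1 ?IH ?mulr0 //; lia.
Qed.

(** * The double sum *)

(* The term of the double sum with n + k = N, the exponents of q being doubled. *)
Definition double_term (a b c n N : int) : laurent int :=
  (-1) ^ N * qhalf ^ (N * (N + 1) + 2 * c * N + 2 * n * n + 2 * n * (a + b)
                        + (a * b + b * c + c * a))
    * qpoch_inv (n + a) * qpoch_inv (n + b) * qpoch_inv (N - n).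

Lemma double_term_euler a b c n k :
  double_term a b c n (n + k) =
  (-1) ^ n
    * qhalf ^ (n * (3 * n + 1) + 2 * n * (a + b + c) + (a * b + b * c + c * a))
    * qpoch_inv (n + a) * qpoch_inv (n + b) * euler_term (n + c) k.
Proof.
rewrite /double_term /euler_term.
have -> : (n + k) * (n + k + 1) + 2 * c * (n + k) + 2 * n * n + 2 * n * (a + b)
    + (a * b + b * c + c * a)
  = (n * (3 * n + 1) + 2 * n * (a + b + c) + (a * b + b * c + c * a))
    + (k * (k + 1) + 2 * k * (n + c)) by ring.
have -> : n + k - n = k by ring.
by rewrite qhalfD signD; ring.
Qed.

Lemma double_term_vandermonde a b c i j :
  double_term a b c (- a + i) (- a + j) =
  (-1) ^ (- a + j) * qhalf ^ ((- a + j) * (- a + j + 1) + 2 * c * (- a + j)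
     + (b * c + c * a - a * b)) * vandermonde_term j (b - a) i.
Proof.
rewrite /double_term /vandermonde_term.
have -> : (- a + j) * (- a + j + 1) + 2 * c * (- a + j) + 2 * (- a + i) * (- a + i)
    + 2 * (- a + i) * (a + b) + (a * b + b * c + c * a)
  = (- a + j) * (- a + j + 1) + 2 * c * (- a + j) + (b * c + c * a - a * b)
    + 2 * (i * (i + (b - a))) by ring.
have -> : - a + i + a = i by ring.
have -> : - a + i + b = i + (b - a) by ring.
have -> : - a + j - (- a + i) = j - i by ring.
by rewrite qhalfD; ring.
Qed.

(** With y = |x| and r = |s| this follows from y^2 - (r+1) y + (r+1)^2 >= 0. The bound is linear in
    |x|, as needed to estimate the exponents of the double sum. *)
Lemma quadratic_ge (s x : int) : `|x| - (`|s| + 1) ^+ 2 <= x * x + s * x.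
Proof.
have : - (`|s| * `|x|) <= s * x by rewrite -normrM lerNl -normrN ler_norm.
have -> : x * x = `|x| * `|x| by rewrite -normrM ger0_norm // -expr2 sqr_ge0.
have : 0 <= `|x| by []. have : 0 <= `|s| by [].
set y := `|x|; set r := `|s|; nia.
Qed.

Lemma double_term_vanish a b c K : exists L, forall i j, (L <= maxn i j)%N ->
  vanish_below K (double_term a b c (- a + i%:Z) (- a + j%:Z)).
Proof.
(* The squares come from [quadratic_ge]; 2|a| pays for replacing |-a + i| and |-a + j| by i and
   j. *)
pose B := (`|2 * c + 1| + 1) ^+ 2 + (`|2 * (a + b)| + 1) ^+ 2
          + `|a * b + b * c + c * a| + `|K| + 2 * `|a| : int.
exists `|B|%N => i j Lij; do 3 apply: vanishMqpoch_inv.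
apply: vanishW (@vanish_monomial _ _).
have := quadratic_ge (2 * c + 1) (- a + j%:Z).
have := quadratic_ge (2 * (a + b)) (- a + i%:Z).
have := ler_norm B; rewrite {2}/B.
set n := - a + i%:Z; set N := - a + j%:Z.
set C := (_ + 1) ^+ 2; set D := (_ + 1) ^+ 2.
have : 0 <= n * n by rewrite -expr2 sqr_ge0.
have -> : N * (N + 1) + 2 * c * N + 2 * n * n + 2 * n * (a + b)
      + (a * b + b * c + c * a)
  = (N * N + (2 * c + 1) * N) + (n * n + 2 * (a + b) * n) + n * n
    + (a * b + b * c + c * a) by ring.
lia.
Qed.

Lemma J_FKB_rows a b c i :
  laurent_cvg (fun N => \sum_(j < N) double_term a b c (- a + i%:Z) (- a + j%:Z))
    (qpoch_inf * J_FKB_term a b c (- a + i%:Z)).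
Proof.
set n := - a + i%:Z.
have E : laurent_cvg (fun N => \sum_(k < N) euler_term (n + c) (0 + k%:Z))
    (qpoch_inf * qpoch_inv (n + c)).
  by under boolp.eq_fun do under eq_bigr do rewrite add0r;
    rewrite -euler_sumE; exact: euler_cvg.
(* Starting at k = -i makes n + k run from -a for every row; the terms with k < 0 are zero. *)
have {}E : laurent_cvg (fun N => \sum_(k < N) euler_term (n + c) (- i%:Z + k%:Z))
    (qpoch_inf * qpoch_inv (n + c)).
  apply: laurent_cvg_start E; first by lia.
  by move=> k k0; rewrite /euler_term qpoch_inv_lt0 ?mulr0.
have := laurent_cvgMl ((-1) ^ n * qhalf ^ (n * (3 * n + 1) + 2 * n * (a + b + c)
  + (a * b + b * c + c * a)) * qpoch_inv (n + a) * qpoch_inv (n + b)) E.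
rewrite (_ : _ * (qpoch_inf * _) = qpoch_inf * J_FKB_term a b c n); last first.
  by rewrite /J_FKB_term; ring.
have sh (j : int) : n + (- i%:Z + j) = - a + j by rewrite /n; lia.
congr laurent_cvg; apply/boolp.funext => N; rewrite mulr_sumr.
by apply: eq_bigr => j _; rewrite -double_term_euler sh.
Qed.

Lemma J_tet_columns a b c j :
  laurent_cvg (fun N => \sum_(i < N) double_term a b c (- a + i%:Z) (- a + j%:Z))
    ((- qhalf) ^ (- b) * tet_index_term (b - c) (a - b) (- (a - b) + j%:Z)).
Proof.
(* Terms with i > j are zero, so the column sum is constant once N > j. *)
move=> K; exists j.+1 => N jN k _.
under eq_bigr do rewrite double_term_vandermonde.
rewrite -mulr_sumr q_vandermonde; last by lia.
congr (coef _ k); rewrite /tet_index_term.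
have -> : - (a - b) + j%:Z + (a - b) = j%:Z by ring.
have -> : - (a - b) + j%:Z = j%:Z + (b - a) by ring.
rewrite (expNrz qhalf); set n := j%:Z + (b - a).
have -> : - a + j%:Z = - b + n by rewrite /n; ring.
have -> : (- b + n) * (- b + n + 1) + 2 * c * (- b + n) + (b * c + c * a - a * b)
  = - b + (n * (n + 1) - (2 * n + (a - b)) * (b - c)) by ring.
by rewrite qhalfD signD; ring.
Qed.

(** * Exchange of the two summations *)

Theorem proposition1p3 (a b c : int) : J_FKB a b c = J_tet a b c.
Proof.
pose F i := qpoch_inf * J_FKB_term a b c (- a + i%:Z).
pose G j := (- qhalf) ^ (- b) * tet_index_term (b - c) (a - b) (- (a - b) + j%:Z).
pose T i j := double_term a b c (- a + i%:Z) (- a + j%:Z).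
have FJ : laurent_cvg (fun N => \sum_(i < N) F i) (J_FKB a b c).
  have H : laurent_cvg (fun N => \sum_(i < N) J_FKB_term a b c (- a + i%:Z))
      (laurent_sum (- Num.min a (Num.min b c)) (J_FKB_term a b c)).
    apply: laurent_cvg_start (laurent_limP (J_FKB_cvg a b c)); first by lia.
    move=> n n_lt; rewrite /J_FKB_term.
    have : n + a < 0 \/ n + b < 0 \/ n + c < 0 by lia.
    by case=> [|[]] /qpoch_inv_lt0 ->; rewrite ?(mulr0, mul0r).
  have := laurent_cvgMl qpoch_inf H.
  by congr laurent_cvg; apply/boolp.funext => N; rewrite mulr_sumr.
have GJ : laurent_cvg (fun N => \sum_(j < N) G j) (J_tet a b c).
  have H : laurent_cvg
      (fun N => \sum_(j < N) tet_index_term (b - c) (a - b) (- (a - b) + j%:Z))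
      (tet_index (b - c) (a - b)).
    apply: laurent_cvg_start (laurent_limP (tet_index_cvg _ _)); first by lia.
    move=> n n_lt; rewrite /tet_index_term.
    have : n < 0 \/ n + (a - b) < 0 by lia.
    by case=> /qpoch_inv_lt0 ->; rewrite ?(mulr0, mul0r).
  have := laurent_cvgMl ((- qhalf) ^ (- b)) H.
  by congr laurent_cvg; apply/boolp.funext => N; rewrite mulr_sumr.
have TK := @double_term_vanish a b c.
have FT := (laurent_cvg_rows (J_FKB a b c) TK (J_FKB_rows a b c)).1 FJ.
apply: laurent_cvg_unique FT _.
(* The transposed array has the same square partial sums, now tending to [J_tet a b c]. *)
have := (laurent_cvg_rows (T := fun j i => T i j) (J_tet a b c) _
  (J_tet_columns a b c)).1 GJ.
under [X in _ -> laurent_cvg X _]boolp.eq_fun do rewrite exchange_big.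
apply=> K; have [L LT] := TK K; exists L => i j Lij; apply: LT.
by rewrite maxnC.
Qed.
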